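(* Let $\lambda<\kappa$ be infinite cardinals with $\lambda$ regular, and let $\mathcal{L}$ be the graph language (one binary relation symbol). If $2^{2^\lambda}>2^\kappa$, then there is an open subset of $\mathrm{Mod}^\kappa_{\mathcal{L}}$ (in the bounded topology) which is closed under isomorphism but is not of the form $\mathrm{Mod}^\kappa_\varphi$ for any $\mathcal{L}_{\kappa^+\kappa}$-sentence $\varphi$.
   Context: No assumption on $\kappa^{<\kappa}$ is made. $\mathrm{Mod}^\kappa_{\mathcal{L}}={}^{\kappa\times\kappa}2$ is the space of $\mathcal{L}$-structures with domain $\kappa$, with the bounded topology generated by the sets $N_s=\{x: s\subseteq x\}$ for $s:\alpha\times\alpha\to2$, $\alpha<\kappa$ (equivalently, transferred from the bounded topology of ${}^\kappa2$ via the Hessenberg pairing bijection). $\mathcal{L}_{\kappa^+\kappa}$ is the infinitary logic closed under negation, conjunctions of sets of $\le\kappa$ formulas having altogether $<\kappa$ free variables, and existential quantification over sets of $<\kappa$ variables. $\mathrm{Mod}^\kappa_\varphi$ is the set of structures in $\mathrm{Mod}^\kappa_{\mathcal{L}}$ satisfying $\varphi$. *)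

(* Defs.v *)
From HB Require Import structures.
From mathcomp Require Import all_boot all_order.
From mathcomp Require Import boolp classical_sets functions cardinality wochoice.
From mathcomp Require Import topology.

Set Implicit Arguments.
Unset Strict Implicit.
Unset Printing Implicit Defensive.

Local Open Scope classical_set_scope.
Local Open Scope card_scope.
Local Open Scope order_scope.

Notation "A '#<' B" := ((A #<= B) && ~~ (B #<= A))
  (at level 79, format "A  '#<'  B") : card_scope.

(* An infinite cardinal is presented as an initial ordinal: a well-ordered
   type all of whose proper initial segments have smaller cardinality.  The
   ordinals alpha < kappa are the initial segments [set x | x < a], a : K. *)
Definition infinite_cardinal d (K : orderType d) : Prop :=
  [/\ well_order (<=%O : rel K),
      forall a : K, [set x | x < a] #< [set: K] &
      infinite_set [set: K]].

(* cof(K) = |K|: every cofinal subset has full cardinality. *)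
Definition regular_cardinal d (K : orderType d) : Prop :=
  infinite_cardinal K /\
  forall A : set K, (forall x, exists2 y, A y & x <= y) -> A #= [set: K].

(* L-structures with domain kappa, for one binary relation symbol. *)
Definition Mod d (K : orderType d) : Type := (K * K -> bool)%type.

#[warnings="-redundant-canonical-projection"]
HB.instance Definition _ d (K : orderType d) := gen_eqMixin (Mod K).
#[warnings="-redundant-canonical-projection"]
HB.instance Definition _ d (K : orderType d) := gen_choiceMixin (Mod K).

(* N_s for s : alpha x alpha -> 2, where alpha = {x | x < a}; s is given by any
   total extension, whose values outside alpha x alpha are irrelevant.  These
   sets generate the bounded topology. *)
Definition basic_open d (K : orderType d) (a : K) (s : K * K -> bool) :
    set (Mod K) :=
  [set M | forall i j, i < a -> j < a -> M (i, j) = s (i, j)].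

#[warnings="-redundant-canonical-projection"]
HB.instance Definition _ d (K : orderType d) :=
  isSubBaseTopological.Build (Mod K)
    [set basic_open p.1 p.2 | p in [set: K * (K * K -> bool)]] id.

Definition isomorphic d (K : orderType d) (M N : Mod K) : Prop :=
  exists2 f : K -> K, bijective f & forall i j, M (i, j) = N (f i, f j).

Definition iso_closed d (K : orderType d) (U : set (Mod K)) : Prop :=
  forall M N : Mod K, isomorphic M N -> U M -> U N.

(* Raw formulas with variables v_a, a : K.  A conjunction of at most kappa
   formulas is a family indexed by a subset of K. *)
Inductive formula (K : Type) : Type :=
| FEq of K & K
| FRel of K & K
| FNot of formula K
| FConj (J : set K) of (J -> formula K)
| FEx (X : set K) of formula K.

Fixpoint free_vars (K : Type) (phi : formula K) : set K :=
  match phi with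
  | FEq x y | FRel x y => [set x; y]
  | FNot psi => free_vars psi
  | FConj J F => \bigcup_i free_vars (F i)
  | FEx X psi => free_vars psi `\` X
  end.

(* The cardinality restrictions cutting out L_{kappa^+ kappa}. *)
Fixpoint is_Lformula (K : Type) (phi : formula K) : Prop :=
  match phi with
  | FEq _ _ | FRel _ _ => True
  | FNot psi => is_Lformula psi
  | FConj J F =>
      (forall i, is_Lformula (F i)) /\
      (\bigcup_i free_vars (F i)) #< [set: K]
  | FEx X psi => is_Lformula psi /\ X #< [set: K]
  end.

Definition is_Lsentence (K : Type) (phi : formula K) : Prop :=
  is_Lformula phi /\ free_vars phi = set0.

(* v assigns elements of the domain kappa to the variables. *)
Fixpoint sat d (K : orderType d) (M : Mod K) (phi : formula K) (v : K -> K) :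
    Prop :=
  match phi with
  | FEq x y => v x = v y
  | FRel x y => M (v x, v y)
  | FNot psi => ~ sat M psi v
  | FConj J F => forall i, sat M (F i) v
  | FEx X psi =>
      exists w : K -> K, (forall x, ~ X x -> w x = v x) /\ sat M psi w
  end.

Definition models d (K : orderType d) (phi : formula K) : set (Mod K) :=
  [set M | forall v, sat M phi v].

(* Main.v *)
Require Import Defs.
From HB Require Import structures.
From mathcomp Require Import all_boot all_order.
From mathcomp Require Import boolp classical_sets functions cardinality wochoice.
From mathcomp Require Import topology.

(* A sentence of the logic is a well-founded tree that can be coded by a subset
   of K, so there are at most 2^K definable classes.  It therefore suffices to
   find open isomorphism-closed sets W_x and structures M_x, for x in 2^L, such
   that M_y belongs to W_x only if x = y: the unions of the W_x over subsets of
   2^L are then 2^(2^L) many open invariant sets.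

   If cof K > L, every copy in K of a structure of size L is bounded, and W_x
   says that a fixed structure S_x embeds.  S_x codes x over the well-order L
   in which every cut of cofinality omega is equipped with a cofinal omega-path;
   a self-embedding moving i moves all the points of the orbit of i, and hence
   the ladder of its supremum, which is impossible.

   If cof K <= L, then L^{++} <= K but a copy of a structure need not be bounded:
   it only is a union of at most L bounded pieces, one of which is positive for
   the club guessing ideal on L^{++}.  Given a club guessing system of ladders
   (t b n), n in L, at points b of cofinality L, colour the pair u < b by x n
   for the least n with u < t b n.  An isomorphism f between positive pieces has
   a club of closed points; at a b whose ladder lies in this club, f fixes b and
   preserves the intervals of the ladder, so x can be read off. *)

Set Implicit Arguments.
Unset Strict Implicit.
Unset Printing Implicit Defensive.

Import Order.TTheory.
Local Open Scope classical_set_scope.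
Local Open Scope card_scope.

(** * Cardinal arithmetic *)

Lemma card_le_rel T U (A : set T) (B : set U) (R : T -> U -> Prop) :
  (forall a, A a -> exists2 b, B b & R a b) ->
  (forall a a' b, R a b -> R a' b -> a = a') -> A #<= B.
Proof.
move=> AB injR.
have /choice[f fP] : forall u : {a | A a}, exists b, B b /\ R (sval u) b.
  by move=> [a Aa]; have [b] := AB a Aa; exists b.
apply/card_leP.
pose g (u : A) : B := SigSub (mem_set (fP (exist _ _ (set_valP u))).1).
apply/injfunPex; exists g => // u v _ _ /(congr1 val) /= guv; apply: val_inj.
apply: injR (fP (exist _ _ (set_valP u))).2 _; rewrite guv.
exact: (fP (exist _ _ (set_valP v))).2.
Qed.

Lemma card_le_surj T U (A : set T) (B : set U) (f : U -> T) :
  (forall a, A a -> exists2 b, B b & f b = a) -> A #<= B.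
Proof. by move=> AB; apply: (card_le_rel AB) => a a' b <- <-. Qed.

Lemma card_le_funP T U (u0 : U) (A : set T) (B : set U) : A #<= B ->
  exists2 f : T -> U, (forall a, A a -> B (f a)) &
    forall a a', A a -> A a' -> f a = f a' -> a = a'.
Proof.
move=> /card_leP /injfunPex[f _ injf].
exists (fun a => if pselect (A a) is left Aa then val (f (SigSub (mem_set Aa))) else u0).
  by move=> a Aa; case: pselect => // Aa'; apply: set_valP.
move=> a a' Aa Aa'; case: pselect => // ?; case: pselect => // ? /val_inj.
by move=> /injf => /(_ (mem_set I) (mem_set I)) /(congr1 val).
Qed.

Lemma card_le_total T U (A : set T) (B : set U) : A #<= B \/ B #<= A.
Proof.
pose P (G : set (T * U)) := [/\ forall a b, G (a, b) -> A a /\ B b,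
  forall a b b', G (a, b) -> G (a, b') -> b = b' &
  forall a a' b, G (a, b) -> G (a', b) -> a = a'].
have [F FP totF|G [[GAB Gfun Ginj] maxG]] := @Zorn_bigcup _ P.
  have dir p q : (\bigcup_(X in F) X) p -> (\bigcup_(X in F) X) q ->
      exists2 X, F X & X p /\ X q.
    move=> [X FX Xp] [Y FY Yq].
    by case: (totF _ _ FX FY) => XY; [exists Y|exists X] => //; split=> //; apply: XY.
  split=> [a b [X /FP[XAB _ _] /XAB]//|a b b' Ga Ga'|a a' b Ga Ga'].
    by have [X /FP[_ fX _] [? ?]] := dir _ _ Ga Ga'; apply: (fX a).
  by have [X /FP[_ _ fX] [? ?]] := dir _ _ Ga Ga'; apply: (fX _ _ b).
have [AG|nAG] := pselect (forall a, A a -> exists b, G (a, b)).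
  left; apply: (@card_le_rel _ _ _ _ (fun a b => G (a, b))) => // a Aa.
  by have [b Gab] := AG a Aa; exists b => //; apply: (GAB _ _ Gab).2.
have [BG|nBG] := pselect (forall b, B b -> exists a, G (a, b)).
  right; apply: (@card_le_rel _ _ _ _ (fun b a => G (a, b))).
    by move=> b Bb; have [a Gab] := BG b Bb; exists a => //; apply: (GAB _ _ Gab).1.
  by move=> b b' a; apply: Gfun.
have [a Aa nGa] : exists2 a, A a & forall b, ~ G (a, b).
  apply: contrapT => h; apply: nAG => a Aa; apply: contrapT => h'.
  by apply: h; exists a => // b Gab; apply: h'; exists b.
have [b Bb nGb] : exists2 b, B b & forall a, ~ G (a, b).
  apply: contrapT => h; apply: nBG => b Bb; apply: contrapT => h'.
  by apply: h; exists b => // a' Gab; apply: h'; exists a'.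
exfalso; apply: (maxG (G `|` [set (a, b)])).
  split; first by move=> p; left.
  by move=> /(_ (a, b)) /(_ (or_intror erefl)) /nGa.
split=> [a' b'|a' b1 b2|a1 a2 b'] /=.
- by case=> [/GAB//|[-> ->]].
- case=> [h1|e1] [h2|e2]; first exact: Gfun h1 h2.
  + by case: e2 => ea _; case: (nGa b1); rewrite -ea.
  + by case: e1 => ea _; case: (nGa b2); rewrite -ea.
  + by case: e1 e2 => _ -> [_ ->].
- case=> [h1|e1] [h2|e2]; first exact: Ginj h1 h2.
  + by case: e2 => _ eb; case: (nGb a1); rewrite -eb.
  + by case: e1 => _ eb; case: (nGb a2); rewrite -eb.
  + by case: e1 e2 => -> _ [-> _].
Qed.

Lemma card_le_setX T T' U U' (A : set T) (A' : set T') (B : set U) (B' : set U') :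
  A #<= A' -> B #<= B' -> A `*` B #<= A' `*` B'.
Proof.
have [[a' _]|nA'] := pselect (exists a', A' a'); last first.
  have -> : A' = set0 by apply/seteqP; split=> // x A'x; case: nA'; exists x.
  by rewrite card_le0 => /eqP-> _; rewrite set0X.
have [[b' _]|nB'] := pselect (exists b', B' b'); last first.
  have -> : B' = set0 by apply/seteqP; split=> // x B'x; case: nB'; exists x.
  by rewrite card_le0 => _ /eqP->; rewrite setX0.
move=> /(card_le_funP a')[f fA finj] /(card_le_funP b')[g gB ginj].
apply: (@card_le_rel _ _ _ _ (fun p q => [/\ A p.1, B p.2 & q = (f p.1, g p.2)])).
  by move=> [a b] /= [Aa Bb]; exists (f a, g b); split=> //=; [apply: fA|apply: gB].
move=> [a b] [a1 b1] _ /= [Aa Bb ->] [Aa1 Bb1 [fa gb]].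
by rewrite (finj a a1) // (ginj b b1).
Qed.

Lemma card_le_setU_square T U (B C : set T) (D : set U) (d0 d1 : U) :
  D d0 -> D d1 -> d0 <> d1 -> D `*` D #<= D ->
  B #<= D -> C #<= D -> B `|` C #<= D.
Proof.
move=> Dd0 Dd1 d01 DD /(card_le_funP d0)[f fB finj] /(card_le_funP d0)[g gC ginj].
apply: card_le_trans DD.
apply: (@card_le_rel _ _ _ _ (fun x q => (B x /\ q = (d0, f x)) \/ (C x /\ q = (d1, g x)))).
  move=> x [Bx|Cx]; [exists (d0, f x); last by left|exists (d1, g x); last by right];
    by split=> //=; auto.
move=> x y _ [[Bx ->]|[Cx ->]] [[Dy e]|[Dy e]].
- by apply: finj; case: e.
- by case: d01; case: e.
- by case: d01; case: e.
- by apply: ginj; case: e.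
Qed.

(* Hessenberg's theorem: a maximal graph of an injection [D `*` D -> D] has
   [D] equipotent to [A], since otherwise [D] embeds in [A `\` D] and the
   injection extends. *)
Lemma card_le_square T (A : set T) : infinite_set A -> A `*` A #<= A.
Proof.
move=> infA.
have [a0 Aa0] : A !=set0 by apply: infinite_setN0.
have [nu nuA nuinj] := card_le_funP a0 ((infiniteP A).1 infA).
pose dom (G : set (T * T * T)) := [set a | exists c, G (a, a, c)].
pose Q (G : set (T * T * T)) := [/\
  forall a b c, G (a, b, c) -> [/\ dom G a, dom G b, dom G c & A a],
  forall a b, dom G a -> dom G b -> exists c, G (a, b, c) &
  forall a b a' b' c, G (a, b, c) -> G (a', b', c) -> (a, b) = (a', b')].
pose G0 := [set p | exists m n, p = (nu m, nu n, nu (pickle (m, n)))] : set (T * T * T).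
have domS (G G' : set (T * T * T)) : G `<=` G' -> dom G `<=` dom G'.
  by move=> GG' a [c] /GG'; exists c.
have domG0 m : dom G0 (nu m) by exists (nu (pickle (m, m))), m, m.
have QG0 : Q G0.
  split.
  - by move=> a b c [m [n [-> -> ->]]]; split=> //; apply: nuA.
  - by move=> a b [c [m [_ [-> _ _]]]] [c' [n [_ [-> _ _]]]];
      exists (nu (pickle (m, n))), m, n.
  - move=> a b a' b' c [m [n [-> -> ->]]] [m' [n' [-> -> e]]].
    by have /(pcan_inj pickleK)[-> ->] := nuinj _ _ I I e.
have [H [QH [G0H maxH]]] : exists H, Q H /\ (G0 `<=` H /\
    forall H', H `<=` H' -> Q H' -> H' `<=` H).
  have [F FP totF|G [PG maxG]] := @Zorn_bigcup _ (fun G => Q (G0 `|` G)).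
    set V := \bigcup_(X in F) X.
    have dir p q : (G0 `|` V) p -> (G0 `|` V) q -> exists X,
        [/\ Q (G0 `|` X), G0 `|` X `<=` G0 `|` V, (G0 `|` X) p & (G0 `|` X) q].
      have sub X : F X -> G0 `|` X `<=` G0 `|` V.
        by move=> FX x [|Xx]; [left|right; exists X].
      move=> [G0p|[X FX Xp]] [G0q|[Y FY Yq]].
      - exists set0; rewrite setU0; split=> //; exact: subsetUl.
      - by exists Y; split; [exact: FP|exact: sub|left|right].
      - by exists X; split; [exact: FP|exact: sub|right|left].
      - case: (totF _ _ FX FY) => XY; [exists Y|exists X];
          by split; [exact: FP|exact: sub|right; auto|right; auto].
    split.
    - move=> a b c h; have [X [[QX _ _] XV Xp _]] := dir _ _ h h.
      by have [? ? ? ?] := QX _ _ _ Xp; split=> //; apply: domS XV _ _.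
    - move=> a b [c h] [c' h']; have [X [[_ QX _] XV Xp Xp']] := dir _ _ h h'.
      have [d Xd] := QX a b (ex_intro _ c Xp) (ex_intro _ c' Xp').
      by exists d; apply: XV.
    - move=> a b a' b' c h h'; have [X [[_ _ QX] _ Xp Xp']] := dir _ _ h h'.
      exact: QX Xp Xp'.
  exists (G0 `|` G); split=> //; split; first exact: subsetUl.
  move=> H' sH QH'; apply: contrapT => nH; apply: (maxG H').
    split=> [x Gx|H'G]; first by apply: sH; right.
    by apply: nH => x /H'G; right.
  have -> // : G0 `|` H' = H'.
  by apply/seteqP; split=> [x [G0x|//]|x]; [apply: sH; left|right].
have [H1 H2 H3] := QH.
set D := dom H in H1 H2.
have DA : D `<=` A by move=> a [c /H1[]].
have Dnu m : D (nu m) by apply: domS G0H _ _.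
have nu01 : nu 0%N <> nu 1%N by move=> /(nuinj _ _ I I).
have DD : D `*` D #<= D.
  apply: (@card_le_rel _ _ _ _ (fun p c => H (p.1, p.2, c))).
    by move=> [a b] /= [Da Db]; have [c Hc] := H2 a b Da Db; exists c => //; case: (H1 _ _ _ Hc).
  by move=> [a b] [a' b'] c; apply: H3.
have [AD|DAD] := card_le_total (A `\` D) D.
  have AleD : A #<= D.
    have -> : A = D `|` (A `\` D) by rewrite setDUK.
    exact: (card_le_setU_square (Dnu 0%N) (Dnu 1%N)).
  apply: card_le_trans (card_le_setX AleD AleD) _.
  by apply: card_le_trans DD _; apply: subset_card_le.
have [g gAD ginj] := card_le_funP a0 DAD.
pose D' := D `|` g @` D.
have DD' : D `<=` D' by move=> x; left.
have D'D : D' #<= D.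
  by apply: (card_le_setU_square (Dnu 0%N) (Dnu 1%N)) => //; apply: card_image_le.
have [E ED Einj] := card_le_funP a0 (card_le_trans (card_le_setX D'D D'D) DD).
pose H' := H `|` [set p | [/\ D' p.1.1, D' p.1.2, ~ (D p.1.1 /\ D p.1.2) & p.2 = g (E p.1)]].
have HH' : H `<=` H' by move=> x; left.
have gnD d : D d -> ~ D (g d) by move=> /gAD[].
have D'A : D' `<=` A by move=> x [/DA//|[d /gAD[Ad _] <-]].
have domH' : dom H' = D'.
  apply/seteqP; split=> [a [c [h|[]//]]|a [Da|[d Dd <-]]].
  - by left; exists c.
  - exact: domS HH' _ Da.
  - exists (g (E (g d, g d))); right; split=> //=; [by right; exists d..|].
    by move=> [/(gnD _ Dd)].
have QH' : Q H'.
  rewrite /Q domH'; split.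
  - move=> a b c [/H1[Da Db Dc Aa]|/= [D'a D'b _ ->]].
      by split=> //; apply: DD'.
    split=> //; last exact: D'A.
    by right; exists (E (a, b)) => //; apply: ED.
  - move=> a b D'a D'b; have [[Da Db]|nD] := pselect (D a /\ D b).
      by have [c Hc] := H2 _ _ Da Db; exists c; left.
    by exists (g (E (a, b))); right.
  - move=> a b a' b' c [h|/= [D'a D'b _ ec]] [h'|/= [D'a' D'b' _ ec']].
    + exact: H3 h h'.
    + have [_ _ Dc _] := H1 _ _ _ h.
      by case: (@gnD (E (a', b'))); rewrite -?ec' //; apply: ED.
    + have [_ _ Dc _] := H1 _ _ _ h'.
      by case: (@gnD (E (a, b))); rewrite -?ec //; apply: ED.
    + apply: Einj => //; apply: ginj; [exact: ED|exact: ED|].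
      by rewrite -ec.
have : D' `<=` D by rewrite -domH'; apply: domS; apply: maxH.
move=> /(_ (g (nu 0%N))) h; case: (gnD _ (Dnu 0%N)); apply: h.
by right; exists (nu 0%N).
Qed.

Lemma card_le_setU T U (B C : set T) (D : set U) : infinite_set D ->
  B #<= D -> C #<= D -> B `|` C #<= D.
Proof.
move=> infD; have [d0 _] := infinite_setN0 infD.
have [nu nuD nuinj] := card_le_funP d0 ((infiniteP D).1 infD).
apply: (@card_le_setU_square _ _ _ _ _ (nu 0%N) (nu 1%N)); try exact: nuD.
  by move=> /(nuinj _ _ I I).
exact: card_le_square.
Qed.

Lemma card_le_bigcup T U V (I : set V) (F : V -> set T) (D : set U) :
  infinite_set D -> I #<= D -> (forall i, I i -> F i #<= D) ->
  \bigcup_(i in I) F i #<= D.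
Proof.
move=> infD ID FD; apply: card_le_trans (card_le_square infD).
have [d0 _] := infinite_setN0 infD.
have [f fD finj] := card_le_funP d0 ID.
have /choice[g gP] i : exists g : T -> U, I i -> (forall x, F i x -> D (g x)) /\
    (forall x y, F i x -> F i y -> g x = g y -> x = y).
  have [Ii|nI] := pselect (I i); last by exists (fun=> d0).
  by have [g gD ginj] := card_le_funP d0 (FD i Ii); exists g.
apply: (@card_le_rel _ _ _ _ (fun x q => exists i, [/\ I i, F i x & q = (f i, g i x)])).
  move=> x [i Ii Fx]; exists (f i, g i x); last by exists i.
  by split=> /=; [apply: fD|apply: (gP i Ii).1].
move=> x y _ [i [Ii Fx ->]] [j [Ij Fy [fij gij]]].
have ij := finj _ _ Ii Ij fij; subst j.
exact: (gP i Ii).2 gij.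
Qed.

(** * Counting formulas *)

Section FormulaCode.
Variables (K : Type) (tag : nat -> K -> K -> K) (k0 : K).

(* Tags 0-4 mark the root connective, tag 5 the codes of the subformulas and
   tag 6 the index set of a conjunction or a quantifier. *)
Fixpoint formula_code (phi : formula K) : set K :=
  match phi with
  | FEq x y => [set tag 0 x y]
  | FRel x y => [set tag 1 x y]
  | FNot psi => tag 2 k0 k0 |` [set tag 5 k0 c | c in formula_code psi]
  | FConj J F => tag 3 k0 k0 |` ([set tag 6 j j | j in J] `|`
      [set z | exists i c, formula_code (F i) c /\ z = tag 5 (val i) c])
  | FEx X psi => tag 4 k0 k0 |` ([set tag 6 x x | x in X] `|`
      [set tag 5 k0 c | c in formula_code psi])
  end.

Hypothesis tag_inj : forall t a b t' a' b',
  tag t a b = tag t' a' b' -> [/\ t = t', a = a' & b = b'].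

Let code_root phi t a b : formula_code phi (tag t a b) -> (t < 5)%N ->
  t = match phi with
      | FEq _ _ => 0 | FRel _ _ => 1 | FNot _ => 2 | FConj _ _ => 3 | FEx _ _ => 4
      end.
Proof.
case: phi => [x y|x y|phi|J F|X phi] /=.
- by move=> /tag_inj[].
- by move=> /tag_inj[].
- by move=> [/tag_inj[]//|[c _ /tag_inj[<-]]].
- by move=> [/tag_inj[]//|[[j _ /tag_inj[<-]]|[i [c [_ /tag_inj[->]]]]]].
- by move=> [/tag_inj[]//|[[x _ /tag_inj[<-]]|[c _ /tag_inj[<-]]]].
Qed.

Let code_root_mem phi : exists t a b, formula_code phi (tag t a b) /\ (t < 5)%N.
Proof.
case: phi => [x y|x y|phi|J F|X phi] /=.
- by exists 0, x, y.
- by exists 1, x, y.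
- by exists 2, k0, k0; split=> //; left.
- by exists 3, k0, k0; split=> //; left.
- by exists 4, k0, k0; split=> //; left.
Qed.

Let code_sub phi a c : formula_code phi (tag 5 a c) =
  match phi with
  | FEq _ _ | FRel _ _ => False
  | FNot psi | FEx _ psi => a = k0 /\ formula_code psi c
  | FConj J F => exists2 i : J, val i = a & formula_code (F i) c
  end.
Proof.
apply/propext; case: phi => [x y|x y|phi|J F|X phi] /=.
- by split=> // /tag_inj[].
- by split=> // /tag_inj[].
- split=> [[/tag_inj[]//|[c' hc' /tag_inj[_ <- <-]//]]|[-> hc]].
  by right; exists c.
- split=> [[/tag_inj[]//|[[j _ /tag_inj[]//]|[i [c' [h /tag_inj[_ -> ->]]]]]]|].
    by exists i.
  by move=> [i <- hc]; right; right; exists i, c.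
- split=> [[/tag_inj[]//|[[j _ /tag_inj[]//]|[c' hc' /tag_inj[_ <- <-]//]]]|[-> hc]].
  by right; right; exists c.
Qed.

Let code_index phi a : formula_code phi (tag 6 a a) =
  match phi with
  | FEq _ _ | FRel _ _ | FNot _ => False
  | FConj J _ => J a
  | FEx X _ => X a
  end.
Proof.
apply/propext; case: phi => [x y|x y|phi|J F|X phi] /=.
- by split=> // /tag_inj[].
- by split=> // /tag_inj[].
- by split=> // -[/tag_inj[]//|[c' hc' /tag_inj[]//]].
- split=> [[/tag_inj[]//|[[j Jj /tag_inj[_ <-]//]|[i [c' [_ /tag_inj[]//]]]]]|].
  by move=> Ja; right; left; exists a.
- split=> [[/tag_inj[]//|[[j Jj /tag_inj[_ <-]//]|[c' _ /tag_inj[]//]]]|].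
  by move=> Ja; right; left; exists a.
Qed.

Lemma formula_code_inj : injective formula_code.
Proof.
pose head (phi : formula K) := match phi with
  | FEq _ _ => 0 | FRel _ _ => 1 | FNot _ => 2 | FConj _ _ => 3 | FEx _ _ => 4
  end%N : nat.
have root phi psi : formula_code phi = formula_code psi -> head phi = head psi.
  move=> e; have [t [a [b [hphi t5]]]] := code_root_mem phi.
  rewrite {1}/head -(code_root hphi t5); rewrite e in hphi.
  exact: code_root hphi t5.
elim=> [x y|x y|phi IH|J F IH|X phi IH] psi e; have := root _ _ e;
  case: psi e => [x' y'|x' y'|psi|J' F'|X' psi] e // _;
  have idx a : formula_code _ (tag 6 a a) = formula_code _ (tag 6 a a) :=
    congr1 (fun X : set K => X (tag 6 a a)) e;
  have sub a c : formula_code _ (tag 5 a c) = formula_code _ (tag 5 a c) :=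
    congr1 (fun X : set K => X (tag 5 a c)) e.
- by have /tag_inj[_ -> ->] : [set tag 0 x' y'] (tag 0 x y) by rewrite -[X in X _]e.
- by have /tag_inj[_ -> ->] : [set tag 1 x' y'] (tag 1 x y) by rewrite -[X in X _]e.
- congr FNot; apply: IH; apply/funext => c.
  have := sub k0 c; rewrite !code_sub => h.
  by apply/propext; split=> hc; [have [] : k0 = k0 /\ formula_code psi c by rewrite -h
    | have [] : k0 = k0 /\ formula_code phi c by rewrite h].
- have JJ' : J = J' by apply/funext => a; have := idx a; rewrite !code_index.
  subst J'; congr FConj; apply/funext => i; apply: IH; apply/funext => c.
  have := sub (val i) c; rewrite !code_sub => h; apply/propext; split=> hc.
    have [i' /val_inj-> //] : exists2 i' : J, val i' = val i & formula_code (F' i') c.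
    by rewrite -h; exists i.
  have [i' /val_inj-> //] : exists2 i' : J, val i' = val i & formula_code (F i') c.
  by rewrite h; exists i.
- have -> : X = X' by apply/funext => a; have := idx a; rewrite !code_index.
  congr FEx; apply: IH; apply/funext => c.
  have := sub k0 c; rewrite !code_sub => h.
  by apply/propext; split=> hc; [have [] : k0 = k0 /\ formula_code psi c by rewrite -h
    | have [] : k0 = k0 /\ formula_code phi c by rewrite h].
Qed.
End FormulaCode.

Lemma card_formula_le K : infinite_set [set: K] ->
  [set: formula K] #<= [set: K -> bool].
Proof.
move=> infK; have [k0 _] := infinite_setN0 infK.
have [nu _ nuinj] := card_le_funP k0 ((infiniteP _).1 infK).
have [pr _ prinj] := card_le_funP k0 (card_le_square infK).
pose tag t a b := pr (nu t, pr (a, b)).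
have tag_inj t a b t' a' b' : tag t a b = tag t' a' b' -> [/\ t = t', a = a' & b = b'].
  move=> /(prinj (_, _) (_, _) (conj I I) (conj I I))[] /(nuinj _ _ I I)->.
  by move=> /(prinj (_, _) (_, _) (conj I I) (conj I I))[] -> ->.
apply: (@card_le_rel _ _ _ _ (fun phi f => f = fun x => `[< formula_code tag k0 phi x >])).
  by move=> phi _; eexists.
move=> phi psi _ -> e; apply: (formula_code_inj (k0 := k0) tag_inj).
by apply/funext => x; have := congr1 (@^~ x) e => /(congr1 is_true); rewrite !asboolE.
Qed.

Lemma open_basic_open d (K : orderType d) (a : K) s : open (basic_open a s).
Proof.
pose S := [set basic_open p.1 p.2 | p in [set: K * (K * K -> bool)]].
exists [set basic_open a s]; last by rewrite bigcup_set1.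
by move=> _ ->; apply: (@finI_from1 _ _ S id); exists (a, s).
Qed.

Lemma open_bounded d (K : orderType d) (U : set (Mod K)) :
  (forall M, U M -> exists a : K, basic_open a M `<=` U) -> open U.
Proof.
move=> UP; pose S := [set p : K * (K * K -> bool) | basic_open p.1 p.2 `<=` U].
have -> : U = \bigcup_(p in S) basic_open p.1 p.2.
  apply/seteqP; split=> [M /UP[a aU]|M [p pU]]; last exact: pU.
  by exists (a, M).
by apply: bigcup_open => p _; apply: open_basic_open.
Qed.

Lemma exists_undefinable d (K : orderType d) (X : Type) (W : X -> set (Mod K))
    (M : X -> Mod K) :
  infinite_set [set: K] -> (forall x, open (W x)) -> (forall x, iso_closed (W x)) ->
  (forall x y, W x (M y) <-> x = y) -> [set: K -> bool] #< [set: X -> bool] ->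
  exists U : set (Mod K), [/\ open U, iso_closed U &
    forall phi : formula K, is_Lsentence phi -> U <> models phi].
Proof.
move=> infK openW isoW WM /andP[_ /negP ltK]; apply: contrapT => noU.
pose U (A : X -> bool) := \bigcup_(x in [set x | A x]) W x.
have /choice[phi phiP] A : exists phi : formula K, U A = models phi.
  apply: contrapT => nphi; apply: noU; exists (U A); split.
  - by apply: bigcup_open => x _.
  - by move=> N N' NN' [x Ax WxN]; exists x => //; apply: isoW NN' WxN.
  - by move=> phi _ e; apply: nphi; exists phi.
apply: ltK; apply: card_le_trans (card_formula_le infK).
apply: (@card_le_rel _ _ _ _ (fun A f => f = phi A)); first by move=> A _; eexists.
move=> A A' _ -> e; have UU : U A = U A' by rewrite !phiP e.
apply/funext => x; apply/idP/idP => Ax.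
  have [y Ay /WM <-//] : U A' (M x) by rewrite -UU; exists x => //; apply/WM.
have [y Ay /WM <-//] : U A (M x) by rewrite UU; exists x => //; apply/WM.
Qed.

Local Open Scope order_scope.

(** * Well-orders and initial ordinals *)

Section WellOrder.
Context d (T : orderType d) (wo : well_order (<=%O : rel T)).

Lemma wo_min (P : T -> Prop) : (exists x, P x) ->
  exists x, P x /\ forall y, P y -> x <= y.
Proof.
move=> [x Px]; have [|z [[/asboolP Pz minz] _]] := wo (A := fun x => `[< P x >]).
  by exists x; apply/asboolP.
by exists z; split=> // y Py; apply: minz; apply/asboolP.
Qed.

Lemma wo_wf : well_founded (fun x y : T => x < y).
Proof.
move=> x; apply: contrapT => nAx.
have [y [nAy miny]] := wo_min (ex_intro (fun x => ~ Acc _ x) x nAx).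
apply: nAy; constructor => z zy; apply: contrapT => /miny.
by rewrite leNgt zy.
Qed.

Lemma wo_choice V (v0 : V) (Q : T -> (T -> V) -> V -> Prop) :
  (forall x f g v, (forall y, y < x -> f y = g y) -> Q x f v -> Q x g v) ->
  (forall x f, exists v, Q x f v) -> exists f, forall x, Q x f (f x).
Proof.
move=> Qext Qex.
pose ext (x : T) (rec : forall y : T, y < x -> V) (y : T) : V :=
  if pselect (y < x) is left h then rec y h else v0.
pose F x rec := sval (cid (Qex x (ext x rec))).
exists (Fix wo_wf _ F) => x; rewrite Fix_eq.
  apply: Qext (svalP (cid (Qex x _))) => y yx.
  by rewrite /ext; case: pselect.
move=> {}x f g fg; congr F.
apply: functional_extensionality_dep => y; exact: functional_extensionality_dep.
Qed.

End WellOrder.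

Section Cardinals.
Context d (K : orderType d) (K_card : infinite_cardinal K).

Lemma infinite_cardinal_wo : well_order (<=%O : rel K). Proof. by case: K_card. Qed.

Lemma infinite_cardinal_infinite : infinite_set [set: K]. Proof. by case: K_card. Qed.

Lemma infinite_cardinal_nomax (a : K) : exists b, a < b.
Proof.
apply: contrapT => nb; have [_ seg inf] := K_card.
have /andP[_ /negP] := seg a; apply.
have Ka : [set: K] = [set x | x < a] `|` [set a].
  apply/seteqP; split=> // x _ /=; have [xa|ax|->] := ltgtP x a; [by left| |by right].
  by case: nb; exists x.
have infa : infinite_set [set x | x < a].
  move=> fina; apply: inf; rewrite Ka finite_setU; split=> //; exact: finite_set1.
rewrite Ka; apply: card_le_setU => //.
have [z za] := infinite_setN0 infa.
by apply: (@card_le_surj _ _ _ _ (fun=> a)) => _ ->; exists z.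
Qed.

Lemma infinite_cardinal_unbounded (A : set K) (a : K) :
  [set: K] #<= A -> exists2 x, A x & a < x.
Proof.
move=> KA; apply: contrapT => nA; have [b ab] := infinite_cardinal_nomax a.
have [_ seg _] := K_card; have /andP[_ /negP] := seg b; apply.
apply: card_le_trans KA _; apply: subset_card_le => x Ax /=; apply: le_lt_trans ab.
by rewrite leNgt; apply/negP => ax; apply: nA; exists x.
Qed.

End Cardinals.

(** * Rigid structures: the case cof K > L *)

Section LadderGraph.
Context d (L : orderType d) (L_card : infinite_cardinal L).
Let wo := infinite_cardinal_wo L_card.

Definition cut (c : option L) : set L :=
  if c is Some l then [set x | x < l] else [set: L].

Definition cofinal_seq (s : nat -> L) (c : option L) :=
  (forall n, cut c (s n)) /\ (forall l, cut c l -> exists n, l < s n).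

Lemma cofinal_seq_uniq s c c' : cofinal_seq s c -> cofinal_seq s c' -> c = c'.
Proof.
have lt_cut l c1 : cofinal_seq s (Some l) -> cofinal_seq s c1 -> ~ cut c1 l.
  move=> [sl _] [_ h] /h[n ln].
  by have /= := sl n; rewrite ltNge (ltW ln).
case: c c' => [l|] [l'|] // sc sc'.
- have := lt_cut _ _ sc sc'; have := lt_cut _ _ sc' sc; rewrite /cut /=.
  by case: (ltgtP l l') => [_ _ []|_ []|->].
- by case: (lt_cut _ _ sc sc').
- by case: (lt_cut _ _ sc' sc).
Qed.

Lemma increasing_cofinal_seq s : (forall n, s n < s n.+1) -> exists c, cofinal_seq s c.
Proof.
move=> s_incr; have [[b sb]|nb] := pselect (exists b, forall n, s n < b); last first.
  exists None; split=> // l _; apply: contrapT => nl; apply: nb.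
  exists l => n; rewrite ltNge; apply/negP => ln; apply: nl.
  by exists n.+1; apply: le_lt_trans ln _.
have [l [sl minl]] := wo_min wo (ex_intro (fun b => forall n, s n < b) b sb).
exists (Some l); split=> // m /= ml; apply: contrapT => nm.
suff : l <= m by rewrite leNgt ml.
apply: minl => n; rewrite ltNge; apply/negP => mn; apply: nm.
by exists n.+1; apply: le_lt_trans mn _.
Qed.

Lemma exists_ladders : exists lad : option L -> nat -> L,
  forall c, cofinal_seq (lad c) c \/
    (forall s, ~ cofinal_seq s c) /\ forall n, lad c n = lad c 0%N.
Proof.
have [l0 _] := infinite_setN0 (infinite_cardinal_infinite L_card).
suff /choice[lad ladP] : forall c, exists lad, cofinal_seq lad c \/
    (forall s, ~ cofinal_seq s c) /\ forall n, lad n = lad 0%N by exists lad.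
move=> c; have [[s sc]|ns] := pselect (exists s, cofinal_seq s c).
  by exists s; left.
by exists (fun=> l0); right; split=> // s sc; apply: ns; exists s.
Qed.

Variable lad : option L -> nat -> L.
Hypothesis ladP : forall c, cofinal_seq (lad c) c \/
  (forall s, ~ cofinal_seq s c) /\ forall n, lad c n = lad c 0%N.

(* Loops mark the vertices [inl _]; the arrows towards these tell [inr (c, 0)]
   and [inr (c, 1)] apart from the rest of the path, which carries the code. *)
Definition ladder_graph (x : L -> bool) (u v : L + option L * nat) : bool :=
  match u, v with
  | inl i, inl j => i <= j
  | inl i, inr (c, n) => i < lad c n
  | inr (c, n), inl i => (n == 0%N) || (1 < n)%N && x i
  | inr (c, n), inr (c', m) => (c == c') && (m == n.+1)
  end.

Lemma ladder_graph_edge x u : exists v, ladder_graph x u v.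
Proof.
case: u => [i|[c n]]; first by exists (inl i) => /=.
by exists (inr (c, n.+1)); rewrite /= !eqxx.
Qed.

Section Embedding.
Variables (x y : L -> bool) (h : L + option L * nat -> L + option L * nat).
Hypothesis hP : forall u v, ladder_graph y (h u) (h v) = ladder_graph x u v.

Let h_inl i : exists j, h (inl i) = inl j.
Proof.
have := hP (inl i) (inl i); case: (h _) => [j _|[c n]]; first by exists j.
by rewrite /= eqxx lexx (ltn_eqF (ltnSn n)).
Qed.

Let h_inr c n : exists p, h (inr (c, n)) = inr p.
Proof.
have := hP (inr (c, n)) (inr (c, n)); case: (h _) => [j|p _]; last by exists p.
by rewrite /= eqxx lexx (ltn_eqF (ltnSn n)).
Qed.

Let h_path c : exists c', forall n, h (inr (c, n)) = inr (c', n).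
Proof.
have [[c' a] hc0] := h_inr c 0%N; exists c'.
have hca n : h (inr (c, n)) = inr (c', (n + a)%N).
  elim: n => // n IH; have := hP (inr (c, n)) (inr (c, n.+1)); rewrite IH.
  have [[c1 m] ->] := h_inr c n.+1.
  by rewrite /= !eqxx => /andP[/eqP<- /eqP->]; rewrite addSn.
have [i _] := infinite_setN0 (infinite_cardinal_infinite L_card).
have [j hi] := h_inl i.
have := hP (inr (c, 0%N)) (inl i); have := hP (inr (c, 1%N)) (inl i).
rewrite !hca hi add0n add1n /=.
by case: a hca {hc0} => [|[|a]] hca //=; [move=> _ _ n; rewrite hca addn0|move=> ->].
Qed.

Lemma ladder_graph_rigid : x =1 y.
Proof.
have /choice[f fP] := h_inl.
have f_le i j : (f i <= f j) = (i <= j) by have := hP (inl i) (inl j); rewrite !fP.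
have f_lt i j : (f i < f j) = (i < j) by rewrite !ltNge f_le.
have f_lad c : exists c', forall i n, (f i < lad c' n) = (i < lad c n).
  have [c' hc'] := h_path c; exists c' => i n.
  by have := hP (inl i) (inr (c, n)); rewrite fP hc'.
have f_ge i : i <= f i.
  rewrite leNgt; apply/negP => fi.
  have [j [fj minj]] := wo_min wo (ex_intro (fun i => f i < i) i fi).
  have := minj (f j); rewrite f_lt => /(_ fj).
  by rewrite leNgt fj.
have f_id i : f i = i.
  apply/eqP; rewrite eq_le f_ge andbT leNgt; apply/negP => fi.
  pose s n := iter n f i.
  have s_incr n : s n < s n.+1 by elim: n => //= n IH; rewrite /s /= f_lt.
  have [c sc] := increasing_cofinal_seq s_incr.
  have cut_down l l' : cut c l' -> l <= l' -> cut c l.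
    by case: c {sc} => //= m l'm ll'; apply: le_lt_trans l'm.
  have [sc1 sc2] := sc.
  have ladc : cofinal_seq (lad c) c by case: (ladP c) => // -[/(_ s)].
  have [lc1 lc2] := ladc.
  have [c' uP] := f_lad c.
  have uc : cofinal_seq (lad c') c.
    split=> [n|l /sc2[k lk]].
      have [k nk] := sc2 _ (lc1 n); apply: (cut_down _ (s k.+1)) => //.
      by rewrite leNgt uP -leNgt ltW.
    have [n kn] := lc2 _ (sc1 k); exists n; apply: lt_trans lk _.
    by apply: lt_trans (s_incr k) _; rewrite uP.
  have cc' : c' = c.
    case: (ladP c') => [/cofinal_seq_uniq/(_ uc)//|[_ cst]].
    by have [n] := uc.2 _ (uc.1 0%N); rewrite cst ltxx.
  rewrite cc' in uP; have [n sn] := lc2 _ (sc1 0%N).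
  have {}sn k : s k < lad c n by elim: k => // k IH; rewrite /s /= uP.
  have [k nk] := sc2 _ (lc1 n).
  by have := lt_trans nk (sn k); rewrite ltxx.
move=> i; have [c' hc] := h_path None.
by have := hP (inr (None, 2%N)) (inl i); rewrite hc fP f_id /=.
Qed.

End Embedding.
End LadderGraph.

Lemma card_ladder_vertices T : infinite_set [set: T] ->
  [set: T + option T * nat] #<= [set: T].
Proof.
move=> infT; have [t0 _] := infinite_setN0 infT.
have [nu _ nuinj] := card_le_funP t0 ((infiniteP _).1 infT).
have {}nuinj m n : nu m = nu n -> m = n by apply: nuinj.
have sqT : [set: T * (T * T)] #<= [set: T].
  rewrite -!setXTT; apply: card_le_trans (card_le_square infT).
  by apply: card_le_setX (card_le_square infT).
apply: card_le_trans sqT.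
pose F (u : T + option T * nat) := match u with
  | inl i => (nu 0, (i, i))
  | inr (Some l, n) => (nu 1, (l, nu n))
  | inr (None, n) => (nu 2, (nu n, nu n))
  end%N.
apply: (@card_le_rel _ _ _ _ (fun u q => q = F u)); first by move=> u _; exists (F u).
move=> u v _ ->; rewrite /F.
by case: u v => [i|[[l|] n]] [j|[[l'|] n']] [] //;
  (try by move=> /nuinj); (try by move=> -> /nuinj->); (try by move=> /nuinj->); move=> ->.
Qed.

Section BoundedCase.
Context dL dK (L : orderType dL) (K : orderType dK).
Hypotheses (L_card : infinite_cardinal L) (infK : infinite_set [set: K]).
Hypothesis LK : [set: L] #<= [set: K].
Hypothesis bounded : forall F : L -> K, exists a, forall l, F l < a.

Lemma bounded_codes : exists (W : (L -> bool) -> set (Mod K)) (M : (L -> bool) -> Mod K),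
  [/\ forall x, open (W x), forall x, iso_closed (W x) &
    forall x y, W x (M y) <-> x = y].
Proof.
have infL := infinite_cardinal_infinite L_card.
have [l0 _] := infinite_setN0 infL.
have [lad ladP] := exists_ladders L_card.
pose S := (L + option L * nat)%type.
have SL : [set: S] #<= [set: L] := card_ladder_vertices infL.
have [j _ jinj] := card_le_funP l0 SL.
have {}jinj u v : j u = j v -> u = v by apply: jinj.
have [k0 _] := infinite_setN0 infK.
have [e _ einj] := card_le_funP k0 LK.
have {}einj u v : e u = e v -> u = v by apply: einj.
pose iota u := e (j u).
have iota_inj u v : iota u = iota v -> u = v by move=> /einj/jinj.
have bounded_S (g : S -> K) : exists a, forall u, g u < a.
  pose r l := if pselect (exists u, j u = l) is left h then g (sval (cid h)) else k0.
  have [a ra] := bounded r; exists a => u.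
  have := ra (j u); rewrite /r; case: pselect => [h|[]]; last by exists u.
  by have /jinj-> := svalP (cid h).
pose M x : Mod K := fun p => `[< exists u v, p = (iota u, iota v) /\ ladder_graph lad x u v >].
pose W x : set (Mod K) := [set N | exists g : S -> K,
  forall u v, N (g u, g v) = ladder_graph lad x u v].
have ME x u v : M x (iota u, iota v) = ladder_graph lad x u v.
  apply/asboolP/idP => [[u' [v' [[/iota_inj<- /iota_inj<-]]]]//|huv].
  by exists u, v.
exists W, M; split=> [x|x N N' [f _ fN] [g gN]|x y].
- apply: open_bounded => N [g gN]; have [a ga] := bounded_S g.
  exists a => N' /= NN'; exists g => u v.
  by rewrite -gN NN'.
- by exists (f \o g) => u v; rewrite -gN fN.
- split=> [[g gN]|<-]; last by exists iota => u v; rewrite ME.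
  have /choice[h hP] u : exists v, g u = iota v.
    have [v uv] := ladder_graph_edge lad x u.
    by have := gN u v; rewrite uv => /asboolP[u' [v' [[-> _] _]]]; exists u'.
  apply/funext; apply: (ladder_graph_rigid L_card ladP (h := h)) => u v.
  by rewrite -ME -!hP gN.
Qed.

End BoundedCase.

(** * Hartogs numbers, clubs and club guessing *)

Section Hartogs.
Context d (K : orderType d) (K_card : infinite_cardinal K).
Let wo := infinite_cardinal_wo K_card.

Definition hartogs U (A : set U) (a : K) :=
  ~ ([set x | x < a] #<= A) /\ forall b, b < a -> [set x | x < b] #<= A.

Lemma exists_hartogs U V (A : set U) (F : V -> K) : infinite_set A ->
  ~ ([set: K] #<= A) -> [set: V] #<= A -> (forall a, exists v, a <= F v) ->
  exists a, hartogs A a.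
Proof.
move=> infA KA VA Fcof.
have [|a [Ka mina]] := @wo_min _ _ wo (fun a => ~ ([set x | x < a] #<= A)).
  apply: contrapT => na; apply: KA.
  suff -> : [set: K] = \bigcup_(v in [set: V]) [set x | x <= F v].
    apply: card_le_bigcup => // v _; have [b vb] := infinite_cardinal_nomax K_card (F v).
    have bA : [set x | x < b] #<= A by apply: contrapT => nb; apply: na; exists b.
    by apply: card_le_trans bA; apply: subset_card_le => x /= /le_lt_trans; apply.
  by apply/seteqP; split=> // x _; have [v xv] := Fcof x; exists v.
exists a; split=> // b ba; apply: contrapT => /mina.
by rewrite leNgt ba.
Qed.

Section HartogsNumber.
Context U (A : set U) (a : K) (infA : infinite_set A) (aA : hartogs A a).

Lemma hartogs_le : A #<= [set x | x < a].
Proof. by have [|/aA.1] := card_le_total A [set x | x < a]. Qed.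

Lemma hartogs_infinite : infinite_set [set x | x < a].
Proof. by move=> fina; apply: infA; apply: card_le_finite hartogs_le fina. Qed.

Lemma hartogs_bounded V (I : set V) (F : V -> K) : I #<= A ->
  (forall i, I i -> F i < a) -> exists2 b, b < a & forall i, I i -> F i < b.
Proof.
move=> IA Fa; apply: contrapT => nb; apply: aA.1.
have [u0 Au0] := infinite_setN0 infA.
suff sub : [set x | x < a] `<=` \bigcup_(i in I) ([set x | x < F i] `|` [set F i]).
  apply: card_le_trans (subset_card_le sub) _; apply: card_le_bigcup => // i Ii.
  apply: card_le_setU => //; first exact/aA.2/Fa.
  by apply: (@card_le_surj _ _ _ _ (fun=> F i)) => _ ->; exists u0.
move=> x /= xa; apply: contrapT => nx; apply: nb; exists x => // i Ii.
have [//|xi|xi] := ltgtP (F i) x; case: nx; exists i => //; [by left|by right].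
Qed.

Lemma hartogs_limit b : b < a -> exists2 c, c < a & b < c.
Proof.
move=> ba; have [u0 Au0] := infinite_setN0 infA.
have [|_ ->|c ca bc] := @hartogs_bounded _ [set b] id; last by exists c => //; apply: bc.
  by apply: (@card_le_surj _ _ _ _ (fun=> b)) => _ ->; exists u0.
by [].
Qed.

Lemma hartogs_sup V (I : set V) (F : V -> K) : I #<= A ->
  (forall i, I i -> F i < a) ->
  exists c, [/\ c < a, forall i, I i -> F i < c &
    forall b, b < c -> exists2 i, I i & b <= F i].
Proof.
move=> IA Fa; have [b ba Fb] := hartogs_bounded IA Fa.
have [c [Fc minc]] := wo_min wo (ex_intro (fun b => forall i, I i -> F i < b) b Fb).
exists c; split=> // [|x xc]; first by apply: le_lt_trans ba; apply: minc.
apply: contrapT => nx; move: xc; rewrite ltNge => /negP; apply; apply: minc => i Ii.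
by rewrite ltNge; apply/negP => xi; apply: nx; exists i.
Qed.

Lemma hartogs_closure (step : K -> K -> Prop) :
  (forall b, b < a -> exists2 c, c < a & b < c /\ step b c) ->
  forall b, b < a -> exists2 c, c < a & b < c /\
    forall x, x < c -> exists u v, [/\ x <= u, u < v, v < c & step u v].
Proof.
move=> stepP b ba.
have /choice[f fP] x : exists y, x < a -> y < a /\ (x < y /\ step x y).
  have [xa|nxa] := pselect (x < a); last by exists x => /nxa.
  by have [y ya [xy sxy]] := stepP x xa; exists y.
pose s n := iter n f b.
have sa n : s n < a by elim: n => //= n IH; rewrite /s /=; exact: (fP _ IH).1.
have natA : [set: nat] #<= A by apply/infiniteP.
have [c [ca sc c_sup]] := hartogs_sup natA (fun n _ => sa n).
exists c => //; split; first exact: (sc 0%N).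
move=> x /c_sup[n _ xn]; exists (s n), (s n.+1).
by split; [|exact: (fP _ (sa n)).2.1|exact: sc|exact: (fP _ (sa n)).2.2].
Qed.

Definition club (C : set K) :=
  (forall b, b < a -> exists2 c, C c & b < c < a) /\
  (forall b, b < a -> (forall x, x < b -> exists2 c, C c & x < c < b) -> C b).

Lemma club_bigcap V (I : set V) (C : V -> set K) : I #<= A ->
  (forall i, I i -> club (C i)) -> club [set c | forall i, I i -> C i c].
Proof.
move=> IA clubC; split=> [b ba|b ba b_lim i Ii]; last first.
  apply: (clubC i Ii).2 => // x /b_lim[c Cc xcb]; exists c => //; exact: Cc.
have [|c ca [bc c_lim]] := @hartogs_closure (fun u v => forall i, I i ->
    exists2 c, C i c & u < c < v) _ b ba.
  move=> u ua; have /choice[f fP] i : exists c, I i -> C i c /\ u < c < a.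
    have [Ii|nI] := pselect (I i); last by exists u.
    by have [c ? ?] := (clubC i Ii).1 u ua; exists c.
  have [|v va fv] := @hartogs_bounded _ I f IA.
    by move=> i /fP[_ /andP[]].
  have [w wa uw] := hartogs_limit ua; exists (Order.max v w).
    by rewrite gt_max va wa.
  split; first by rewrite lt_max uw orbT.
  move=> i Ii; have [Cf /andP[uf _]] := fP i Ii; exists (f i) => //.
  by rewrite uf lt_max fv.
exists c; last by rewrite bc ca.
move=> i Ii; apply: (clubC i Ii).2 => // x /c_lim[u [v [xu uv vc /(_ i Ii)[e Ce /andP[ue ev]]]]].
by exists e => //; rewrite (le_lt_trans xu ue) (lt_trans ev vc).
Qed.

Lemma club_closed_points (f : K -> K) : (forall b, b < a -> f b < a) ->
  club [set c | forall b, b < c -> f b < c].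
Proof.
move=> fa; split=> [b ba|b ba b_lim x /b_lim[c fc /andP[xc cb]]]; last first.
  exact: lt_trans (fc _ xc) cb.
have [|c ca [bc c_lim]] := @hartogs_closure (fun u v => forall x, x <= u -> f x < v) _ b ba.
  move=> u ua; have [w wa uw] := hartogs_limit ua.
  have [|v va fv] := @hartogs_bounded _ [set x | x < w] f (aA.2 _ wa).
    by move=> i /= iw; apply: fa; apply: lt_trans iw wa.
  exists (Order.max v w); first by rewrite gt_max va wa.
  split=> [|x xu]; first by rewrite lt_max uw orbT.
  by rewrite lt_max fv //=; apply: le_lt_trans xu uw.
exists c; last by rewrite bc ca.
move=> x /c_lim[u [v [xu uv vc h]]]; apply: lt_trans vc.
exact: h.
Qed.

Lemma club_max (C : set K) b : club C -> b < a ->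
  exists c, [/\ C c, c <= b & forall x, C x -> x <= b -> x <= c].
Proof.
move=> [_ C_closed] ba.
have [|c [c_ub minc]] := @wo_min _ _ wo (fun c => forall x, C x -> x <= b -> x <= c).
  by exists b.
have cb : c <= b by apply: minc.
exists c; split=> //; apply: contrapT => nCc; apply: (nCc); apply: C_closed.
  exact: le_lt_trans cb ba.
move=> x xc; apply: contrapT => nx; move: xc; rewrite ltNge => /negP; apply.
apply: minc => y Cy yb; rewrite leNgt; apply/negP => xy; apply: nx.
exists y => //; rewrite xy lt_neqAle c_ub // andbT /=.
by apply/eqP => yc; apply: nCc; rewrite -yc.
Qed.

End HartogsNumber.
End Hartogs.

Section Ladders.
Context dL dK (L : orderType dL) (K : orderType dK).
Hypotheses (L_reg : regular_cardinal L) (K_card : infinite_cardinal K).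
Let L_card := L_reg.1.
Let woL := infinite_cardinal_wo L_card.
Let wo := infinite_cardinal_wo K_card.

Definition cofinal_in (c : K) (s : L -> K) :=
  [/\ forall n, s n < c, forall m n, m < n -> s m < s n &
    forall b, b < c -> exists n, b < s n].

Lemma cofinal_in_bounded c s (n : L) (f : L -> K) : cofinal_in c s ->
  (forall m, m < n -> f m < c) -> exists2 b, b < c & forall m, m < n -> f m < b.
Proof.
move=> [s_lt s_incr s_cof] fc.
have /choice[k kP] m : exists k, m < n -> f m < s k.
  have [mn|nmn] := pselect (m < n); last by exists m => /nmn.
  by have [k] := s_cof _ (fc m mn); exists k.
have [x xP] : exists x, forall m, m < n -> k m < x.
  apply: contrapT => nx; have [_ seg _] := L_card.
  have /andP[_ /negP] := seg n; apply.
  suff /L_reg.2 : forall x, exists2 y, (k @` [set m | m < n]) y & x <= y.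
    by move=> e; rewrite -(card_le_eql e); apply: card_image_le.
  move=> x; apply: contrapT => nxy; apply: nx; exists x => m mn.
  rewrite ltNge; apply/negP => xk; by apply: nxy; exists (k m).
exists (s x) => // m mn; apply: lt_trans (kP m mn) _; apply: s_incr; exact: xP.
Qed.

(* The gap below each [s n] makes [n] the least index whose rung exceeds some
   point, even at limit [n]. *)
Definition ladder (c : K) (s : L -> K) :=
  [/\ forall n, s n < c, forall b, b < c -> exists n, b < s n &
    forall n, exists2 e, e < s n & forall m, m < n -> s m <= e].

Lemma ladder_cofinal_in c s : ladder c s -> cofinal_in c s.
Proof.
move=> [s_lt s_cof s_gap]; split=> // m n mn; have [e en me] := s_gap n.
exact: le_lt_trans (me m mn) en.
Qed.

Context (a1 a2 : K).
Hypotheses (a1P : hartogs [set: L] a1) (a2P : hartogs [set x | x < a1] a2).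
Let infL := infinite_cardinal_infinite L_card.
Let infa1 := hartogs_infinite infL a1P.

Definition limit_point_of (C : set K) (c : K) :=
  forall b, b < c -> exists2 x, C x & b < x < c.

Lemma club_limit_point C : club a2 C ->
  exists2 c, c < a2 & limit_point_of C c /\ exists s, cofinal_in c s.
Proof.
move=> clubC; have La1 := hartogs_le a1P.
have [x0 x0a] := infinite_setN0 (hartogs_infinite infa1 a2P).
have segL (n : L) : [set m | m < n] #<= [set x | x < a1].
  exact: card_le_trans (card_leT _) La1.
have [||s sP] := @wo_choice _ _ woL _ x0 (fun n f v => (forall m, m < n -> f m < a2) ->
    [/\ C v, v < a2 & forall m, m < n -> f m < v]).
- move=> n f g v fg fP ga.
  have [|Cv va fv] := fP; first by move=> m mn; rewrite fg //; apply: ga.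
  by split=> // m mn; rewrite -fg //; apply: fv.
- move=> n f; have [fa|nfa] := pselect (forall m, m < n -> f m < a2); last first.
    by exists x0 => /nfa.
  have [b ba fb] := hartogs_bounded infa1 a2P (segL n) fa.
  have [c Cc /andP[bc ca]] := clubC.1 b ba.
  by exists c => _; split=> // m mn; apply: lt_trans (fb m mn) bc.
have {}sP n : [/\ C (s n), s n < a2 & forall m, m < n -> s m < s n].
  elim/(well_founded_ind (wo_wf woL)): n => n IH.
  by apply: sP => m /IH[].
have [|c [ca sc c_sup]] := hartogs_sup K_card infa1 a2P La1 (F := s).
  by move=> n _; case: (sP n).
have c_cof b : b < c -> exists2 n, True & b < s n.
  move=> /c_sup[n _ bn]; have [m nm] := infinite_cardinal_nomax L_card n.
  exists m => //; apply: le_lt_trans bn _; case: (sP m) => _ _; exact.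
exists c => //; split.
  by move=> b /c_cof[n _ bn]; exists (s n); [case: (sP n)|rewrite bn sc].
exists s; split=> [n|m n mn|b /c_cof[n _ bn]]; [exact: sc|by case: (sP n) => _ _; apply|].
by exists n.
Qed.

(* Shelah's club guessing: trimming a fixed system of cofinal sequences by a
   decreasing sequence of length lambda^+ of clubs, each refuting the
   previous trimming, would stabilise at some point of their intersection. *)
Lemma club_guessing : exists (c : K -> L -> K) (E : set K) (mx : K -> K),
  [/\ club a2 E, forall b, b < a2 -> [/\ E (mx b), mx b <= b &
        forall x, E x -> x <= b -> x <= mx b] &
    forall C, club a2 C -> exists2 b, b < a2 &
      [/\ cofinal_in b (c b), limit_point_of E b & forall n, C (mx (c b n))]].
Proof.
have [x0 x0a] := infinite_setN0 (hartogs_infinite infa1 a2P).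
have /choice[c cP] b : exists s, (exists s, cofinal_in b s) -> cofinal_in b s.
  have [[s sP]|ns] := pselect (exists s, cofinal_in b s); first by exists s.
  by exists (fun=> x0) => /ns.
have /choice[mx0 mx0P] (p : set K * K) : exists e, club a2 p.1 -> p.2 < a2 ->
    [/\ p.1 e, e <= p.2 & forall x, p.1 x -> x <= p.2 -> x <= e].
  have [clubE|nE] := pselect (club a2 p.1); last by exists x0 => /nE.
  have [ba|nba] := pselect (p.2 < a2); last by exists x0 => _ /nba.
  by have [e eP] := club_max K_card clubE ba; exists e.
pose mx E b := mx0 (E, b).
have mxP E b : club a2 E -> b < a2 -> [/\ E (mx E b), mx E b <= b &
    forall x, E x -> x <= b -> x <= mx E b] by apply: (mx0P (E, b)).
apply: contrapT => no_guess.
have /choice[N NP] E : exists C, club a2 E -> club a2 C /\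
    forall b, b < a2 -> cofinal_in b (c b) -> limit_point_of E b ->
      ~ forall n, C (mx E (c b n)).
  have [clubE|nE] := pselect (club a2 E); last by exists set0 => /nE.
  apply: contrapT => nC; apply: no_guess; exists c, E, (mx E); split=> //.
    by move=> b; apply: mxP.
  move=> C clubC; apply: contrapT => nb; apply: nC; exists C => _; split=> // b ba cb accb Cmx.
  by apply: nb; exists b.
have [||E EP] := @wo_choice _ _ wo (set K) set0
    (fun i f v => v = [set x | forall j, j < i -> N (f j) x]).
- by move=> i f g v fg ->; apply/seteqP; split=> x h j ji; have := h j ji; rewrite fg.
- by move=> i f; eexists.
have E_club i : i <= a1 -> club a2 (E i).
  elim/(well_founded_ind (wo_wf wo)): i => i IH ia; rewrite EP.
  apply: (club_bigcap K_card infa1 a2P (I := [set j | j < i]) (C := fun j => N (E j))).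
    by apply: subset_card_le => j /= ji; apply: lt_le_trans ia.
  move=> j /= ji; apply: (NP (E j) _).1; apply: IH => //; apply: ltW.
  exact: lt_le_trans ia.
have E_sub i j : i <= j -> E j `<=` E i.
  by move=> ij x; rewrite !EP => h k ki; apply: h; apply: lt_le_trans ki ij.
have [b ba [accb /cP cb]] := club_limit_point (E_club a1 (lexx _)).
have [c_lt _ _] := cb.
have ca n : c b n < a2 by apply: lt_trans (c_lt n) ba.
have [y0 y0a] := infinite_setN0 infa1.
have /choice[i iP] n : exists i, i < a1 /\
    forall j, i <= j -> j < a1 -> mx (E j) (c b n) = mx (E i) (c b n).
  have [|e [[i ia ie] mine]] :=
      @wo_min _ _ wo (fun e => exists2 i, i < a1 & mx (E i) (c b n) = e).
    by exists (mx (E y0) (c b n)), y0.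
  exists i; split=> // j ij ja; apply/eqP; rewrite eq_le ie mine ?andbT; last by exists j.
  have [_ _ max_i] := mxP _ _ (E_club i (ltW ia)) (ca n).
  have [Ej j_le _] := mxP _ _ (E_club j (ltW ja)) (ca n).
  by rewrite -ie; apply: max_i => //; apply: E_sub ij _ _.
have [||j ja ij] := hartogs_bounded infL a1P (I := [set: L]) (F := i) => //.
  by move=> n _; exact: (iP n).1.
have [k ka jk] := hartogs_limit infL a1P ja.
apply: ((NP (E j) (E_club j (ltW ja))).2 b ba cb) => [x /accb[y Ey xyb]|n].
  by exists y => //; apply: E_sub (ltW ja) _ Ey.
have ijn := ij n I; have [_ icst] := iP n.
rewrite (icst j (ltW ijn) ja) -(icst k (ltW (lt_trans ijn jk)) ka).
have [+ _ _] := mxP _ _ (E_club k (ltW ka)) (ca n).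
by rewrite {1}EP; apply.
Qed.

Theorem ladder_guessing : exists t : K -> L -> K, forall C, club a2 C ->
  exists2 b, b < a2 & ladder b (t b) /\ forall n, C (t b n).
Proof.
have [c [E [mx [clubE mxP guess]]]] := club_guessing.
have [x0 _] := infinite_setN0 (hartogs_infinite infa1 a2P).
suff /choice[t tP] b : exists t, b < a2 -> cofinal_in b (c b) -> limit_point_of E b ->
    ladder b t /\ forall n, exists k, t n = mx (c b k).
  exists t => C /guess[b ba [cb accb Cmx]]; exists b => //.
  by have [tb tmx] := tP b ba cb accb; split=> // n; have [k ->] := tmx n.
have [[ba cb accb]|nh] := pselect [/\ b < a2, cofinal_in b (c b) & limit_point_of E b];
  last by exists (fun=> x0) => ba cb accb; case: nh.
have [c_lt _ c_cof] := cb.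
have mx_lt k : mx (c b k) < b.
  have [_ + _] := mxP _ (lt_trans (c_lt k) ba).
  by move/le_lt_trans; apply.
have [||t tP] := @wo_choice _ _ woL _ x0 (fun n f v => (forall m, m < n -> f m < b) ->
    [/\ exists k, v = mx (c b k), c b n < v & exists2 e, e < v & forall m, m < n -> f m <= e]).
- move=> n f g v fg fP ga.
  have [|kv cv [e ev fe]] := fP; first by move=> m mn; rewrite fg //; apply: ga.
  by split=> //; exists e => // m mn; rewrite -fg //; apply: fe.
- move=> n f; have [fa|nfa] := pselect (forall m, m < n -> f m < b); last first.
    by exists x0 => /nfa.
  have [e eb fe] := cofinal_in_bounded cb fa.
  have eb' : Order.max e (c b n) < b by rewrite gt_max eb c_lt.
  have [x Ex /andP[ex xb]] := accb _ eb'; have [k xk] := c_cof x xb.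
  have [_ _ mx_max] := mxP _ (lt_trans (c_lt k) ba).
  have x_le := mx_max x Ex (ltW xk); have := lt_le_trans ex x_le.
  rewrite gt_max => /andP[e_lt c_lt'].
  exists (mx (c b k)) => _; split=> //; first by exists k.
  by exists e => // m mn; apply: ltW; apply: fe.
have t_lt n : t n < b.
  elim/(well_founded_ind (wo_wf woL)): n => n IH.
  by have [|[k ->] _ _] := tP n.
have {}tP n := tP n (fun m _ => t_lt m).
exists t => _ _ _; split; last by move=> n; case: (tP n).
split=> //; last by move=> n; case: (tP n).
move=> x /c_cof[n xn]; exists n; apply: lt_trans xn _.
by case: (tP n).
Qed.

End Ladders.

(** * Club guessing graphs: the case cof K <= L *)

Lemma exists_alternating d (L : orderType d) : infinite_cardinal L ->
  exists p : L -> bool, forall c n, exists2 m, n < m & p m = c.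
Proof.
move=> L_card; have infL := infinite_cardinal_infinite L_card.
have [l0 _] := infinite_setN0 infL.
have [l1 l01] := infinite_cardinal_nomax L_card l0.
have [e _ einj] := card_le_funP l0 (card_le_square infL).
have {}einj u v : e u = e v -> u = v.
  by case: u v => [u1 u2] [v1 v2] /(einj _ _ (conj I I) (conj I I)).
pose p m := `[< exists l, m = e (l0, l) >].
have unb l n : exists2 m, n < m & exists l', m = e (l, l').
  have [|m [l' _ <-] nm] := @infinite_cardinal_unbounded _ L L_card (range (fun l' => e (l, l'))) n.
    apply: (@card_le_rel _ _ _ _ (fun l' m => m = e (l, l'))).
      by move=> l' _; exists (e (l, l')) => //; exists l'.
    by move=> u v _ -> /einj[].
  by exists (e (l, l')) => //; exists l'.
exists p => -[] n.
  by have [m nm [l' ml']] := unb l0 n; exists m => //; apply/asboolP; exists l'.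
have [m nm [l' ml']] := unb l1 n; exists m => //; apply/asboolP => -[l].
by rewrite ml' => /einj[e1]; move: l01; rewrite e1 ltxx.
Qed.

Section GuessingGraph.
Context dL dK (L : orderType dL) (K : orderType dK).
Hypotheses (L_reg : regular_cardinal L) (K_card : infinite_cardinal K).
Let L_card := L_reg.1.
Let woL := infinite_cardinal_wo L_card.
Let infL := infinite_cardinal_infinite L_card.

Context (a1 a2 : K) (t : K -> L -> K) (p : L -> bool).
Hypotheses (a1P : hartogs [set: L] a1) (a2P : hartogs [set x | x < a1] a2).
Hypothesis guess : forall C, club a2 C ->
  exists2 b, b < a2 & ladder b (t b) /\ forall n, C (t b n).
Hypothesis alt : forall c n, exists2 m, n < m & p m = c.
Let infa1 := hartogs_infinite infL a1P.

Lemma exists_rung : exists r : K -> K -> L, forall b x n,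
  x < t b n -> (forall m, m < n -> t b m <= x) -> r b x = n.
Proof.
have [l0 _] := infinite_setN0 infL.
suff /choice[r rP] (q : K * K) : exists k, forall n, q.2 < t q.1 n ->
    (forall m, m < n -> t q.1 m <= q.2) -> k = n.
  by exists (fun b x => r (b, x)) => b x; apply: (rP (b, x)).
have [[n [qn mn]]|nn] := pselect (exists n, q.2 < t q.1 n /\ forall m, m < n -> t q.1 m <= q.2).
  exists n => n' qn' mn'; have [nn'|n'n|//] := ltgtP n n'.
    by have := mn' _ nn'; rewrite leNgt qn.
  by have := mn _ n'n; rewrite leNgt qn'.
by exists l0 => n qn mn; case: nn; exists n.
Qed.

Variable r : K -> K -> L.
Hypothesis rP : forall b x n,
  x < t b n -> (forall m, m < n -> t b m <= x) -> r b x = n.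

(* The arrow from the smaller to the larger endpoint carries the code [x]; the
   converse arrow carries [p], which betrays the supremum of the rungs. *)
Definition guess_graph (x : L -> bool) (u v : K) : bool :=
  [|| u == v, [&& u < v, `[< ladder v (t v) >] & x (r v u)] |
      [&& v < u, `[< ladder u (t u) >] & p (r u v)]].

Lemma guess_graph_refl x u : guess_graph x u u.
Proof. by rewrite /guess_graph eqxx. Qed.

Lemma guess_graph_lt x u v : u < v ->
  guess_graph x u v = `[< ladder v (t v) >] && x (r v u).
Proof. by move=> uv; rewrite /guess_graph lt_eqF // uv (lt_gtF uv) /= orbF. Qed.

Lemma guess_graph_gt x u v : v < u ->
  guess_graph x u v = `[< ladder u (t u) >] && p (r u v).
Proof. by move=> vu; rewrite /guess_graph gt_eqF // vu (lt_gtF vu). Qed.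

Definition guessing (B : set K) := forall C, club a2 C ->
  exists b, [/\ B b, b < a2, ladder b (t b) & forall n, C (t b n)].

Lemma guessing_all : guessing [set u | u < a2].
Proof. by move=> C /guess[b ba [lb Cb]]; exists b. Qed.

Lemma guessing_bigcup V (B : V -> set K) : [set: V] #<= [set: L] ->
  guessing (\bigcup_v B v) -> exists v, guessing (B v).
Proof.
move=> VL gB; apply: contrapT => ng.
have /choice[C CP] v : exists C, club a2 C /\
    forall b, B v b -> b < a2 -> ladder b (t b) -> ~ forall n, C (t b n).
  apply: contrapT => nC; apply: ng; exists v => C clubC; apply: contrapT => nb.
  apply: nC; exists C; split=> // b Bb ba lb Cb; apply: nb.
  by exists b.
have [|b [[v _ Bvb] ba lb Cb]] := gB [set c | forall v, [set: V] v -> C v c].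
  apply: (club_bigcap K_card infa1 a2P) => [|v _]; last exact: (CP v).1.
  exact: card_le_trans VL (hartogs_le a1P).
by apply: (CP v).2 Bvb ba lb _ => n; apply: Cb.
Qed.

Section Embedding.
Variables (x y : L -> bool) (B : set K) (f : K -> K).
Hypotheses (B_guess : guessing B) (Ba2 : forall u, B u -> u < a2).
Hypotheses (fa2 : forall u, B u -> f u < a2).
Hypothesis f_inj : forall u v, B u -> B v -> f u = f v -> u = v.
Hypothesis fP : forall u v, B u -> B v ->
  guess_graph y (f u) (f v) = guess_graph x u v.

Let B_unbounded c : c < a2 -> exists u, [/\ B u, u < a2 & c < u].
Proof.
move=> ca; have [|b [Bb ba [t_lt _ t_gap] tC]] := B_guess (C := [set d | forall b, b < d -> c < d]).
  exact: (club_closed_points K_card infa1 a2P (f := fun=> c)).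
have [l0 _] := infinite_setN0 infL.
exists b; split=> //; have [e e_lt _] := t_gap l0.
exact: lt_trans (tC l0 _ e_lt) (t_lt l0).
Qed.

Lemma guess_graph_rigid : x =1 y.
Proof.
have /choice[w wP] c : exists w, c < a2 -> [/\ w < a2, B c -> f c <= w,
    forall u, B u -> f u = c -> u <= w & exists u, [/\ B u, c < u & u <= w]].
  have [ca|nca] := pselect (c < a2); last by exists c => /nca.
  have [u3 [Bu3 u3a cu3]] := B_unbounded ca.
  have [w1 w1a fw1] : exists2 w1, w1 < a2 & (B c -> f c <= w1).
    by have [Bc|nBc] := pselect (B c); [exists (f c) => //; apply: fa2|exists c].
  have [w2 w2a fw2] : exists2 w2, w2 < a2 & (forall u, B u -> f u = c -> u <= w2).
    have [[u [Bu fu]]|nu] := pselect (exists u, B u /\ f u = c); last first.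
      by exists c => // u Bu fu; case: nu; exists u.
    exists u; first exact: Ba2.
    by move=> v Bv fv; rewrite (f_inj Bu Bv) // fu.
  exists (Order.max (Order.max w1 w2) u3) => _; split.
  - by rewrite !gt_max w1a w2a.
  - by move=> /fw1 h; rewrite !le_max h.
  - by move=> u Bu /(fw2 _ Bu) h; rewrite !le_max h orbT.
  - by exists u3; split=> //; rewrite le_max lexx orbT.
have [|b [Bb ba lb tC]] := B_guess (C := [set d | forall b, b < d -> w b < d]).
  by apply: (club_closed_points K_card infa1 a2P) => c /wP[].
have [t_lt t_cof t_gap] := lb.
have lbT : `[< ladder b (t b) >] by apply/asboolP.
have ta n : t b n < a2 by apply: lt_trans (t_lt n) ba.
have f_lt n u : B u -> (f u < t b n) = (u < t b n).
  move=> Bu; apply/idP/idP => h.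
    have [_ _ ule _] := wP _ (lt_trans h (ta n)).
    exact: le_lt_trans (ule u Bu erefl) (tC n _ h).
  have [_ fle _ _] := wP _ (lt_trans h (ta n)).
  exact: le_lt_trans (fle Bu) (tC n _ h).
have rung n : exists u, [/\ B u, u < t b n, forall m, m < n -> t b m <= u &
    forall m, m < n -> t b m <= f u].
  have [e e_lt me] := t_gap n.
  have [_ _ _ [u [Bu eu uw]]] := wP _ (lt_trans e_lt (ta n)).
  have tu m : m < n -> t b m <= u by move=> /me/le_trans; apply; apply: ltW.
  exists u; split=> //; first exact: le_lt_trans uw (tC n _ e_lt).
  by move=> m mn; rewrite leNgt f_lt // -leNgt tu.
have fb : f b = b.
  apply/eqP; rewrite eq_le; apply/andP; split; rewrite leNgt; apply/negP => h.
    have key u n : B u -> u < t b n -> (forall m, m < n -> t b m <= u) ->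
        p n = `[< ladder (f b) (t (f b)) >] && p (r (f b) (f u)).
      move=> Bu un mu; have ub := lt_trans un (t_lt n).
      have fub : f u < b by apply: lt_trans (t_lt n); rewrite f_lt.
      have := fP Bb Bu; rewrite (guess_graph_gt _ ub) lbT /= (rP un mu) => <-.
      by rewrite guess_graph_gt // (lt_trans fub).
    have [lfb|nlfb] := pselect (ladder (f b) (t (f b))); last first.
      have [l0 _] := infinite_setN0 infL.
      have [n _ pn] := alt true l0; have [u [Bu un mu _]] := rung n.
      by have := key u n Bu un mu; rewrite pn (asboolF nlfb).
    have [_ t'_cof _] := lfb; have [n1 bn1] := t'_cof _ h.
    have [n0 [bn0 n0_min]] := wo_min woL (ex_intro (fun n => b <= t (f b) n) n1 (ltW bn1)).
    have [|e eb mn0] := @cofinal_in_bounded _ _ _ _ L_reg b (t b) n0 (t (f b)) (ladder_cofinal_in lb).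
      by move=> m mn0; rewrite ltNge; apply/negP => /n0_min; rewrite leNgt mn0.
    have [N eN] := t_cof e eb.
    have [n Nn pn] := alt (~~ p n0) N; have [u [Bu un mu mfu]] := rung n.
    have := key u n Bu un mu; rewrite (asboolT lfb) pn /= (@rP _ _ n0); first by case: (p n0).
      apply: lt_le_trans bn0; apply: lt_trans (t_lt n).
      by rewrite f_lt.
    move=> m /mn0 me; apply: ltW; apply: lt_trans me _.
    exact: lt_le_trans eN (mfu _ Nn).
  by have [n] := t_cof _ h; rewrite f_lt // ltNge (ltW (t_lt n)).
move=> n; have [u [Bu un mu mfu]] := rung n.
have fun_ : f u < t b n by rewrite f_lt.
have := fP Bu Bb; rewrite fb !guess_graph_lt ?(lt_trans _ (t_lt n)) // lbT /=.
by rewrite (rP un mu) (rP fun_ mfu).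
Qed.

End Embedding.

Lemma cofinal_codes (F : L -> K) : (forall a, exists l, a <= F l) ->
  exists (W : (L -> bool) -> set (Mod K)) (M : (L -> bool) -> Mod K),
  [/\ forall x, open (W x), forall x, iso_closed (W x) &
    forall x y, W x (M y) <-> x = y].
Proof.
move=> F_cof.
pose emb x (N : Mod K) (B : set K) (g : K -> K) := [/\ forall u, B u -> u < a2,
  guessing B, forall u v, B u -> B v -> g u = g v -> u = v &
  forall u v, B u -> B v -> N (g u, g v) = guess_graph x u v].
pose W x : set (Mod K) := [set N | exists a B g, emb x N B g /\ forall u, B u -> g u < a].
pose M x : Mod K := fun q => [&& q.1 < a2, q.2 < a2 & guess_graph x q.1 q.2].
have emb_W x N B g : emb x N B g -> W x N.
  move=> [Ba gB ginj gN].
  have [|l gBl] := @guessing_bigcup _ (fun l => B `&` [set u | g u <= F l]) (card_lexx _).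
    move=> C /gB[b [Bb ba lb tC]]; exists b; split=> //.
    by have [l bl] := F_cof (g b); exists l.
  have [a Fa] := infinite_cardinal_nomax K_card (F l).
  exists a, (B `&` [set u | g u <= F l]), g; split; last first.
    by move=> u [_ /= /le_lt_trans]; apply.
  split=> // [u [/Ba]//|u v [Bu _] [Bv _]|u v [Bu _] [Bv _]]; first exact: ginj.
  exact: gN.
exists W, M; split=> [x|x N N' [h /bij_inj h_inj hN] [a [B [g [[Ba gB ginj gN] ga]]]]|x y].
- apply: open_bounded => N [a [B [g [[Ba gB ginj gN] ga]]]]; exists a => N' /= NN'.
  exists a, B, g; split=> //; split=> // u v Bu Bv.
  by rewrite NN' ?gN //; apply: ga.
- apply: (emb_W x N' B (h \o g)); split=> // [u v Bu Bv /h_inj|u v Bu Bv]; first exact: ginj.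
  by rewrite /= -hN gN.
- split=> [[a [B [g [[Ba gB ginj gN] _]]]]|<-]; last first.
    apply: (emb_W x _ [set u | u < a2] id); split=> // [|u v /= ua va].
      exact: guessing_all.
    by rewrite /M /= ua va.
  have ga u : B u -> g u < a2.
    by move=> Bu; have := gN u u Bu Bu; rewrite guess_graph_refl => /and3P[].
  apply/funext; apply: (guess_graph_rigid gB Ba ga ginj) => u v Bu Bv.
  by rewrite -(gN u v) // /M /= !ga.
Qed.

End GuessingGraph.

Theorem theorem4p4 (dL dK : Order.disp_t) (L : orderType dL) (K : orderType dK)
    (L_regular : regular_cardinal L) (K_cardinal : infinite_cardinal K)
    (ltLK : [set: L] #< [set: K])
    (lt_pow : [set: K -> bool] #< [set: (L -> bool) -> bool]) :
  exists U : set (Mod K),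
    [/\ open U, iso_closed U &
        forall phi : formula K, is_Lsentence phi -> U <> models phi].
Proof.
have L_card := L_regular.1.
have infL := infinite_cardinal_infinite L_card.
have infK := infinite_cardinal_infinite K_cardinal.
have /andP[LK /negP nKL] := ltLK.
suff [W [M [openW isoW WM]]] : exists (W : (L -> bool) -> set (Mod K))
    (M : (L -> bool) -> Mod K), [/\ forall x, open (W x),
    forall x, iso_closed (W x) & forall x y, W x (M y) <-> x = y].
  exact: exists_undefinable infK openW isoW WM lt_pow.
have [bnd|nbnd] := pselect (forall F : L -> K, exists a, forall l, (F l < a)%O).
  exact: bounded_codes L_card infK LK bnd.
have [F F_cof] : exists F : L -> K, forall a, exists l, (a <= F l)%O.
  apply: contrapT => nF; apply: nbnd => F; apply: contrapT => na; apply: nF.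
  exists F => a; apply: contrapT => nl; apply: na; exists a => l.
  by rewrite ltNge; apply/negP => al; apply: nl; exists l.
have [a1 a1P] := exists_hartogs K_cardinal infL nKL (card_lexx _) F_cof.
have infa1 := hartogs_infinite infL a1P.
have [a2 a2P] : exists a2 : K, hartogs [set x : K | (x < a1)%O] a2.
  apply: (exists_hartogs K_cardinal infa1 _ (hartogs_le a1P) F_cof).
  by have [_ seg _] := K_cardinal; have /andP[_ /negP] := seg a1.
have [t guess] := ladder_guessing L_regular K_cardinal a1P a2P.
have [p alt] := exists_alternating L_card.
have [r rP] := exists_rung L_regular t.
exact: (cofinal_codes L_regular K_cardinal a1P a2P guess alt rP F_cof).
Qed.
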